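(* Let $X$ be a real Hilbert space and let $\beta\in(0,1)$. For closed linear subspaces $U,V$ of $X$ with $U\subsetneqq X$ and $U\not\subseteq V$, set $$T_1:=P_U,\qquad T_2:=(1-\beta)\operatorname{Id}+\beta R_V,\qquad T:=T_2T_1 .$$ Then $\kappa(T_1)=\tfrac12$, $\kappa(T_2)=\beta$, and the Ogura--Yamada bound $$\frac{\kappa(T_1)+\kappa(T_2)-2\kappa(T_1)\kappa(T_2)}{1-\kappa(T_1)\kappa(T_2)}$$ equals $\frac{1}{2-\beta}$. Moreover: (a) If $c_F(U,V)=1$, then $\kappa(T)=\frac{1}{2-\beta}$, i.e., $\kappa(T)$ coincides with the Ogura--Yamada bound. (b) If $X$ is finite-dimensional, then $c_F(U,V)<1$ and $\kappa(T)<\frac{1}{2-\beta}$. (c) If $X$ is infinite-dimensional, then there exist closed linear subspaces $U,V$ of $X$ with $U\cap V=\{0\}$ and $c_F(U,V)=1$; consequently the Ogura--Yamada bound is attained, i.e., it is optimal.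
   Context: $X$ is a real Hilbert space with inner product $\langle\cdot,\cdot\rangle$ and induced norm $\|\cdot\|$; $\operatorname{Id}$ is the identity operator on $X$. A map $T\colon X\to X$ is nonexpansive if $\|Tx-Ty\|\le\|x-y\|$ for all $x,y\in X$. For $\kappa\in[0,1]$, $T$ is called $\kappa$-averaged if there is a nonexpansive $N\colon X\to X$ with $T=(1-\kappa)\operatorname{Id}+\kappa N$; $T$ is averaged if it is $\kappa$-averaged for some $\kappa\in[0,1)$. For a nonexpansive $T\colon X\to X$, the modulus of averagedness is $\kappa(T):=\min\{\kappa\in[0,1] : T \text{ is } \kappa\text{-averaged}\}$ (the minimum is attained). The Ogura--Yamada theorem (known) states that for averaged $T_1,T_2\colon X\to X$ one has $\kappa(T_2T_1)\le \frac{\kappa(T_1)+\kappa(T_2)-2\kappa(T_1)\kappa(T_2)}{1-\kappa(T_1)\kappa(T_2)}$; the right-hand side is the Ogura--Yamada bound. For a closed linear subspace $V$ of $X$, $P_V$ is the orthogonal projection onto $V$, $V^\perp$ is the orthogonal complement, and $R_V:=P_V-P_{V^\perp}$ is the reflector. The cosine of the Friedrichs angle between closed linear subspaces $U,V$ of $X$ is $$c_F(U,V):=\sup\{\langle u,v\rangle : u\in U\cap(U\cap V)^\perp,\ v\in V\cap(U\cap V)^\perp,\ \|u\|\le 1,\ \|v\|\le 1\}.$$ *)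

(* Defs.v *)
From HB Require Import structures.
From mathcomp Require Import all_boot all_order all_algebra.
From mathcomp Require Import ring lra.
From mathcomp Require Import all_classical all_reals all_analysis.

Set Implicit Arguments.
Unset Strict Implicit.
Unset Printing Implicit Defensive.

Import Order.TTheory GRing.Theory Num.Theory.
Import numFieldNormedType.Exports.

Local Open Scope classical_set_scope.
Local Open Scope ring_scope.

Section Averagedness.
Context {R : realType} {X : normedModType R}.
Implicit Types (T N : X -> X) (k : R).

Definition nonexpansive T := forall x y, `|T x - T y| <= `|x - y|.

Definition relax k N : X -> X := fun x => (1 - k) *: x + k *: N x.

Definition averaged_by k T :=
  0 <= k <= 1 /\ exists N, nonexpansive N /\ T = relax k N.

(* The minimum of the set of admissible constants, and 0 if there is none.
   [modulus_min] below shows that the minimum exists when T is nonexpansive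
   and T 0 = 0. A translation by a nonzero vector is nonexpansive and has no
   minimum: it is k-averaged exactly for 0 < k <= 1. *)
Definition modulus T : R :=
  xget 0 [set k | averaged_by k T /\ forall k', averaged_by k' T -> k <= k'].

Lemma averaged_by1 T : nonexpansive T -> averaged_by 1 T.
Proof.
move=> Tne; split; first by rewrite ler01 lexx.
exists T; split=> //; apply/funext => x.
by rewrite /relax subrr scale0r add0r scale1r.
Qed.

Lemma averaged_by_dist k T x y : averaged_by k T ->
  `|(T x - T y) - (1 - k) *: (x - y)| <= k * `|x - y|.
Proof.
move=> [/andP[k0 _] [N [Nne ->]]]; rewrite /relax.
rewrite opprD addrACA -!scalerBr addrAC subrr add0r normrZ ger0_norm//.
exact: ler_wpM2l.
Qed.

Lemma averaged_by_of_dist k T : 0 < k <= 1 ->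
  (forall x y, `|(T x - T y) - (1 - k) *: (x - y)| <= k * `|x - y|) ->
  averaged_by k T.
Proof.
move=> /andP[k0 k1] H; split; first by rewrite ltW.
exists (fun x => k^-1 *: (T x - (1 - k) *: x)); split; last first.
  apply/funext => x; rewrite /relax scalerA divff ?gt_eqF// scale1r.
  by rewrite addrC subrK.
move=> x y; rewrite -scalerBr normrZ gtr0_norm ?invr_gt0// ler_pdivrMl//.
suff -> : T x - (1 - k) *: x - (T y - (1 - k) *: y) =
    (T x - T y) - (1 - k) *: (x - y) by exact: H.
by rewrite scalerBr opprD addrACA -opprD.
Qed.

Lemma modulus_min T : nonexpansive T -> T 0 = 0 ->
  averaged_by (modulus T) T /\ forall k, averaged_by k T -> modulus T <= k.
Proof.
move=> Tne T0; set S := [set k | averaged_by k T].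
have S1 : S 1 by exact: averaged_by1.
have Slb : has_inf S by split; [exists 1 | exists 0 => k [/andP[]]].
have lbS k : S k -> inf S <= k by move=> Sk; apply: ge_inf => //; case: Slb.
have i0 : 0 <= inf S by apply: lb_le_inf; [exists 1 | move=> k [/andP[]]].
have Hd x y : `|(T x - T y) - (1 - inf S) *: (x - y)| <= inf S * `|x - y|.
  apply/ler_addgt0Pr => e e0.
  have d0 : 0 < e / (2 * (`|x - y| + 1)).
    by rewrite divr_gt0// mulr_gt0// ltr_wpDl.
  have [k Sk kS] := inf_adherent d0 Slb.
  have ik : 0 <= k - inf S by rewrite subr_ge0 lbS.
  have := averaged_by_dist x y Sk.
  have -> : (1 - inf S) *: (x - y) =
      (1 - k) *: (x - y) + (k - inf S) *: (x - y).
    by rewrite -scalerDl addrA subrK.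
  move=> Hk; rewrite opprD addrA; apply: le_trans (ler_normB _ _) _.
  rewrite normrZ (ger0_norm ik); apply: le_trans (lerD Hk (lexx _)) _.
  have : (k - inf S) * `|x - y| * 2 <= e.
    have : (k - inf S) * (`|x - y| + 1) * 2 <= e.
      rewrite -mulrA [_ * 2]mulrC -ler_pdivlMr ?mulr_gt0 ?ltr_wpDl//.
      by rewrite lerBlDl ltW.
    apply: le_trans; rewrite ler_wpM2r// ler_wpM2l// lerDl//.
  by rewrite mulrBl; lra.
have Si : S (inf S).
  have [ipos|] := ltP 0 (inf S).
    by apply: averaged_by_of_dist => //; rewrite ipos lbS.
  move=> ile0; have i00 : inf S = 0 by apply/eqP; rewrite eq_le ile0.
  suff S0 : S 0 by rewrite i00.
  split; first by rewrite lexx ler01.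
  exists T; split=> //; apply/funext => x.
  have := Hd x 0; rewrite i00 T0 !subr0 mul0r scale1r normr_le0 subr_eq0.
  by move=> /eqP ->; rewrite /relax subr0 scale1r scale0r addr0.
rewrite /modulus; case: xgetP => [k _ []//|/(_ (inf S))].
by case; split=> // k; exact: lbS.
Qed.

End Averagedness.

Definition OY_bound {R : realType} (k1 k2 : R) : R :=
  (k1 + k2 - 2 * k1 * k2) / (1 - k1 * k2).

(* A real Hilbert space is a complete normed module X with an inner product
   dot such that `|x| ^+ 2 = dot x x. No definition below needs this last
   equation, so it is left as a hypothesis to the theorems. *)
Section Hilbert.
Context {R : realType} {X : completeNormedModType R}.
Variable dot : {dot X for idfun}.
Implicit Types U V : set X.

Definition closed_subspace U :=
  [/\ U 0, forall (a : R) u v, U u -> U v -> U (a *: u + v) & closed U].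

Definition orthc V : set X := [set x | forall v, V v -> dot x v = 0].

(* The default value 0 is not used when V is a closed subspace of a Hilbert
   space, by the projection theorem. *)
Definition orth_proj V : X -> X :=
  fun x => xget 0 [set p | V p /\ orthc V (x - p)].

Definition reflector V : X -> X :=
  fun x => orth_proj V x - orth_proj (orthc V) x.

Definition cos_friedrichs U V : R :=
  sup [set r | exists u v,
    [/\ (U `&` orthc (U `&` V)) u, (V `&` orthc (U `&` V)) v,
        `|u| <= 1, `|v| <= 1 & r = dot u v]].

End Hilbert.

Definition finite_dimensional {R : realType} (X : lmodType R) : Prop :=
  exists (n : nat) (e : 'I_n -> X),
    forall x, exists c : 'I_n -> R, x = \sum_(i < n) c i *: e i.

(* Main.v *)
Require Import Defs.
From HB Require Import structures.
From mathcomp Require Import all_boot all_order all_algebra.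
From mathcomp Require Import ring lra.
From mathcomp Require Import all_classical all_reals all_analysis.

Set Implicit Arguments.
Unset Strict Implicit.
Unset Printing Implicit Defensive.

Import Order.TTheory GRing.Theory Num.Theory.
Import numFieldNormedType.Exports.

Local Open Scope classical_set_scope.
Local Open Scope ring_scope.

(* For u = P_U x, w = x - u and q = u - P_V u, the map T is k-averaged iff
   (1 - k) |w + 2 b q|^2 <= k (|w|^2 + 4 b (1 - b) |q|^2) for all x, where b is
   beta. At k0 = 1 / (2 - b) the right side exceeds the left one by
   k0 b |w - 2 (1 - b) q|^2, so k0 always works, and the choice
   w = 2 (1 - b) P_(U^perp) q shows that T is k-averaged for some k < k0 iff
   e |q|^2 <= |P_U q|^2 on U for some e > 0. The latter bounds the operator
   u |-> P_(V^perp) u below by sqrt e on U `&` (U `&` V)^perp, hence forces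
   c_F(U, V) < 1; in finite dimension it holds for every U and V. *)

(** * Inner product, closed subspaces and the projection theorem *)

Section InnerProduct.
Context {R : realType} {X : completeNormedModType R}.
Variable dot : {dot X for idfun}.
Hypothesis normE : forall x : X, `|x| ^+ 2 = dot x x.
Implicit Types (x y z u v : X) (a b : R) (U V W : set X).

Lemma dotC x y : dot x y = dot y x.
Proof. by rewrite hermC expr0 mul1r. Qed.

Lemma dot0l x : dot 0 x = 0. Proof. exact: linear0l. Qed.
Lemma dot0r x : dot x 0 = 0. Proof. exact: linear0r. Qed.
Lemma dotDl x y z : dot (x + y) z = dot x z + dot y z.
Proof. exact: linearDl. Qed.
Lemma dotDr x y z : dot z (x + y) = dot z x + dot z y.
Proof. exact: linearDr. Qed.
Lemma dotNl x y : dot (- x) y = - dot x y. Proof. exact: linearNl. Qed.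
Lemma dotNr x y : dot x (- y) = - dot x y. Proof. exact: linearNr. Qed.
Lemma dotZl a x y : dot (a *: x) y = a * dot x y.
Proof. exact: linearZl_LR. Qed.
Lemma dotZr a x y : dot x (a *: y) = a * dot x y.
Proof. by rewrite dotC dotZl dotC. Qed.

Lemma dot_suml (I : finType) (F : I -> X) y :
  dot (\sum_i F i) y = \sum_i dot (F i) y.
Proof. exact: linear_sumlz. Qed.

Definition dotE := (dotDl, dotDr, dotNl, dotNr, dotZl, dotZr).

Lemma dot_ge0 x : 0 <= dot x x. Proof. by rewrite -normE sqr_ge0. Qed.

Lemma dot_eq0 x : dot x x = 0 -> x = 0.
Proof. by move/eqP; rewrite -normE sqrf_eq0 normr_eq0 => /eqP. Qed.

(** Cauchy-Schwarz: the squared norm of [dot y y *: x - dot x y *: y] is [dot y y] times the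
    difference of the two sides. *)
Lemma sqr_dot_le x y : dot x y ^+ 2 <= dot x x * dot y y.
Proof.
have := dot_ge0 (dot y y *: x - dot x y *: y).
rewrite !dotE (dotC y x).
have [y0|yn] := eqVneq (dot y y) 0.
  by move=> _; rewrite (dot_eq0 y0) !dot0r expr0n mulr0.
have yp : 0 < dot y y by rewrite lt_neqAle eq_sym yn dot_ge0.
by move=> H; rewrite -(ler_pM2l yp); nra.
Qed.

Lemma norm_le_dot x y : `|x| <= `|y| <-> dot x x <= dot y y.
Proof. by rewrite -!normE ler_sqr ?nnegrE. Qed.

Lemma normr_dot_le x y : `|dot x y| <= `|x| * `|y|.
Proof.
rewrite -ler_sqr ?nnegrE ?mulr_ge0// exprMn -normrX ger0_norm ?sqr_ge0//.
by rewrite !normE sqr_dot_le.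
Qed.

Lemma dot_le_norm x y : dot x y <= `|x| * `|y|.
Proof. exact: le_trans (ler_norm _) (normr_dot_le _ _). Qed.

Lemma closure_norm (A : set X) x :
  closure A x <-> forall e, 0 < e -> exists2 y, A y & `|x - y| < e.
Proof.
split=> [Ax e e0|H B /nbhs_ballP[e /= e0 xB]].
  have [y [Ay]] := Ax _ (nbhsx_ballx x _ e0).
  by rewrite -ball_normE /= => xy; exists y.
by have [y Ay xy] := H _ e0; exists y; split=> //; apply: xB; rewrite -ball_normE.
Qed.

Lemma subspaceD V x y : closed_subspace V -> V x -> V y -> V (x + y).
Proof. by case=> _ H _ Vx Vy; rewrite -(scale1r x); exact: H. Qed.

Lemma subspaceZ V a x : closed_subspace V -> V x -> V (a *: x).
Proof. by case=> V0 H _ Vx; rewrite -(addr0 (_ *: _)); exact: H. Qed.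

Lemma subspaceN V x : closed_subspace V -> V x -> V (- x).
Proof. by rewrite -scaleN1r; exact: subspaceZ. Qed.

Lemma subspaceB V x y : closed_subspace V -> V x -> V y -> V (x - y).
Proof. by move=> cV Vx Vy; apply: subspaceD => //; exact: subspaceN. Qed.

Lemma closed_subspace_orthc (V : set X) : closed_subspace (orthc dot V).
Proof.
split=> [v _|a x y Vx Vy v Vv|].
- exact: dot0l.
- by rewrite !dotE Vx// Vy// mulr0 addr0.
- rewrite closure_id; apply/seteqP; split; first exact: subset_closure.
  move=> x /closure_norm xV v Vv; apply/eqP/negPn/negP => xv.
  (* Within this radius of [x], Cauchy-Schwarz forbids [dot y v = 0]; the 1 keeps the divisor
     positive. *)
  have c0 : 0 < `|dot x v| / (`|v| + 1).
    by rewrite divr_gt0 ?normr_gt0 ?ltr_wpDl.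
  have [y Vy] := xV _ c0; rewrite ltr_pdivlMr ?ltr_wpDl// ltNge.
  move=> /negP; apply.
  have -> : dot x v = dot (x - y) v by rewrite !dotE (Vy v Vv) subr0.
  apply: le_trans (_ : `|x - y| * `|v| <= _); last first.
    by rewrite ler_wpM2l// lerDl.
  exact: normr_dot_le.
Qed.

Lemma closed_subspace_closure V : V 0 ->
  (forall a u v, V u -> V v -> V (a *: u + v)) -> closed_subspace (closure V).
Proof.
move=> V0 VP; split; [exact: subset_closure| |exact: closed_closure].
move=> a u v /closure_norm cu /closure_norm cv; apply/closure_norm => e e0.
have a0 : 0 < `|a| + 1 by rewrite ltr_wpDl.
have e2 : 0 < e / 2 / (`|a| + 1) by rewrite !divr_gt0.
have e2' : 0 < e / 2 by rewrite !divr_gt0.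
have [u' Vu' uu'] := cu _ e2.
have [v' Vv' vv'] := cv _ e2'.
exists (a *: u' + v'); first exact: VP.
rewrite opprD addrACA -scalerBr; apply: le_lt_trans (ler_normD _ _) _.
rewrite normrZ (splitr e) ler_ltD//.
move: uu'; rewrite ltr_pdivlMr// mulrC => /ltW; apply: le_trans.
by rewrite ler_wpM2r// lerDl.
Qed.

(* A minimizing sequence is Cauchy by the parallelogram law. *)
Lemma projection_theorem V x : closed_subspace V ->
  exists p, V p /\ orthc dot V (x - p).
Proof.
move=> cV; case: (cV) => V0 VP clV.
pose S := [set r | exists2 v, V v & r = dot (x - v) (x - v)].
have hS : has_inf S.
  split; first by exists (dot (x - 0) (x - 0)), 0.
  by exists 0 => _ [v _ ->]; exact: dot_ge0.
pose d := inf S.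
have dle v : V v -> d <= dot (x - v) (x - v).
  by move=> Vv; apply: ge_inf; [case: hS|exists v].
have near_d n : exists v, V v /\ dot (x - v) (x - v) < d + n.+1%:R^-1.
  have n0 : 0 < n.+1%:R^-1 :> R by rewrite invr_gt0.
  by have [_ [v Vv ->] ?] := inf_adherent n0 hS; exists v.
have [vn vnP] := choice near_d.
have dist n m : `|vn n - vn m| ^+ 2 <= 2 * n.+1%:R^-1 + 2 * m.+1%:R^-1.
  have [[Vn Dn] [Vm Dm]] := (vnP n, vnP m).
  have := dle _ (subspaceZ 2^-1 cV (subspaceD cV Vn Vm)).
  move: Dn Dm; rewrite normE !dotE.
  rewrite (dotC (vn n) x) (dotC (vn m) x) (dotC (vn m) (vn n)).
  by move: n.+1%:R^-1 m.+1%:R^-1 => A B; lra.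
have : cvg (vn @ \oo).
  apply/cauchy_cvgP/cauchy_exP => e e0.
  have e4 : 0 < e ^+ 2 / 4 by rewrite divr_gt0// exprn_gt0.
  have [N _ NP] := near_infty_natSinv_lt (PosNum e4).
  exists (vn N); exists N => // m /= Nm.
  rewrite -ball_normE /= -ltr_sqr ?nnegrE ?(ltW e0)//.
  apply: le_lt_trans (dist _ _) _.
  have := NP N (leqnn _); have := NP m Nm; rewrite /=.
  by move: N.+1%:R^-1 m.+1%:R^-1 => A B; lra.
move=> /cvg_ex[p vp]; exists p.
have Vp : V p.
  by apply: (closed_cvg V clV _ p vp); apply: nearW => n; case: (vnP n).
split=> //.
have pd : dot (x - p) (x - p) <= d.
  have c1 : `|x - vn n| ^+ 2 @[n --> \oo] --> `|x - p| ^+ 2.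
    apply: cvgM; apply: cvg_norm; apply: cvgB => //; exact: cvg_cst.
  have c2 : d + n.+1%:R^-1 @[n --> \oo] --> d + 0.
    by apply: cvgD; [exact: cvg_cst|exact: cvg_harmonic].
  rewrite -normE -(addr0 d); apply: ler_cvg_to c1 c2 _.
  by apply: nearW => n; rewrite normE; case: (vnP n) => _ /ltW.
move=> v Vv; have [v0|vn0] := eqVneq (dot v v) 0.
  by rewrite (dot_eq0 v0) dot0r.
have vpos : 0 < dot v v by rewrite lt_neqAle eq_sym vn0 dot_ge0.
(* Moving [p] by [t *: v] with this optimal [t] lowers the squared distance to [x] by
   [t ^+ 2 * dot v v], so minimality forces [t = 0]. *)
pose t := dot (x - p) v / dot v v.
have := dle _ (subspaceD cV Vp (subspaceZ t cV Vv)).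
have tE : dot (x - p) v = t * dot v v by rewrite divfK.
clearbody t.
rewrite opprD addrA; move: tE pd; move: (x - p) => z tE zd.
rewrite !dotE (dotC v z) tE => H.
have : t ^+ 2 * dot v v <= 0 by lra.
rewrite pmulr_lle0// => t0; have : t ^+ 2 == 0 by rewrite eq_le t0 sqr_ge0.
by rewrite sqrf_eq0 => /eqP ->; rewrite mul0r.
Qed.

End InnerProduct.

(** * Algebra of orthogonal projections and reflectors *)

Section OrthogonalProjection.
Context {R : realType} {X : completeNormedModType R}.
Variable dot : {dot X for idfun}.
Hypothesis normE : forall x : X, `|x| ^+ 2 = dot x x.
Implicit Types (x y z u v w : X) (a b k : R) (U V W : set X).
Local Notation P := (orth_proj dot).

(** The projection theorem rules out the default value of [xget]. *)
Lemma orth_projP V x : closed_subspace V -> V (P V x) /\ orthc dot V (x - P V x).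
Proof.
move=> cV; rewrite /orth_proj; case: xgetP => [p _ //|np].
by have [p /np] := projection_theorem normE x cV.
Qed.

Lemma orth_proj_in V x : closed_subspace V -> V (P V x).
Proof. by move=> /(orth_projP x)[]. Qed.

Lemma orth_proj_residual V x v : closed_subspace V -> V v ->
  dot (x - P V x) v = 0.
Proof. by move=> /(orth_projP x)[_]; apply. Qed.

Lemma orth_proj_unique V x p : closed_subspace V ->
  V p -> orthc dot V (x - p) -> P V x = p.
Proof.
move=> cV Vp xp; have [VP xP] := orth_projP x cV.
apply/eqP; rewrite -subr_eq0; apply/eqP/(dot_eq0 normE).
have Vd : V (P V x - p) by exact: subspaceB.
have -> d : dot (P V x - p) d = dot (x - p) d - dot (x - P V x) d.
  by rewrite !dotE; ring.
by rewrite (xp _ Vd) (xP _ Vd) subrr.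
Qed.

Lemma orth_proj_id V x : closed_subspace V -> V x -> P V x = x.
Proof.
by move=> cV Vx; apply: orth_proj_unique => // v _; rewrite subrr dot0l.
Qed.

Lemma orth_proj0 V x : closed_subspace V -> orthc dot V x -> P V x = 0.
Proof. by move=> cV Vx; apply: orth_proj_unique; rewrite ?subr0//; case: cV. Qed.

Lemma orth_projB V x y : closed_subspace V -> P V (x - y) = P V x - P V y.
Proof.
move=> cV; apply: orth_proj_unique => //.
  by apply: subspaceB => //; exact: orth_proj_in.
move=> v Vv; have := orth_proj_residual x cV Vv.
by have := orth_proj_residual y cV Vv; rewrite !dotE; lra.
Qed.

Lemma orth_proj_linear V a x y : closed_subspace V ->
  P V (a *: x + y) = a *: P V x + P V y.
Proof.
move=> cV; apply: orth_proj_unique => //.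
  by case: (cV) => _ + _; apply; exact: orth_proj_in.
move=> v Vv; rewrite opprD addrACA -scalerBr dotDl dotZl.
by rewrite !(orth_proj_residual _ cV Vv) mulr0 addr0.
Qed.

Lemma orth_proj_orthc V x : closed_subspace V -> P (orthc dot V) x = x - P V x.
Proof.
move=> cV; apply: orth_proj_unique; first exact: closed_subspace_orthc.
  by case: (orth_projP x cV).
by rewrite opprB addrC subrK => v; rewrite dotC; apply; exact: orth_proj_in.
Qed.

Lemma relax_reflectorE V b x : closed_subspace V ->
  relax b (reflector dot V) x = x - (2 * b) *: (x - P V x).
Proof.
move=> cV; rewrite /relax /reflector orth_proj_orthc//.
have -> : P V x - (x - P V x) = x - 2 *: (x - P V x).
  by rewrite scaler_nat mulr2n [in RHS](opprD (x - _)) addrA subKr.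
by rewrite scalerBr addrA -scalerDl subrK scale1r scalerA mulrC.
Qed.

Lemma dot_residual V x : closed_subspace V ->
  dot x (x - P V x) = dot (x - P V x) (x - P V x).
Proof.
move=> cV; have := orth_proj_residual x cV (orth_proj_in x cV).
by rewrite !dotE [dot (P V x) x]dotC; lra.
Qed.

Lemma dot_projE V x : closed_subspace V ->
  dot x x = dot (P V x) (P V x) + dot (x - P V x) (x - P V x).
Proof.
move=> cV; have := orth_proj_residual x cV (orth_proj_in x cV).
by rewrite !dotE [dot (P V x) x]dotC; lra.
Qed.

Lemma norm_orth_proj_le V x : closed_subspace V -> `|P V x| <= `|x|.
Proof.
move=> cV; rewrite (norm_le_dot normE) [leRHS](dot_projE x cV) lerDl.
exact: dot_ge0.
Qed.

Lemma dot_orth_proj_l V x v : closed_subspace V -> V v ->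
  dot (P V x) v = dot x v.
Proof.
move=> cV Vv; have := orth_proj_residual x cV Vv.
by rewrite !dotE; lra.
Qed.

Lemma orth_proj_sym V x y : closed_subspace V -> dot (P V x) y = dot x (P V y).
Proof.
move=> cV; rewrite -(dot_orth_proj_l x cV (orth_proj_in y cV)).
by rewrite dotC [RHS]dotC dot_orth_proj_l//; exact: orth_proj_in.
Qed.

End OrthogonalProjection.

(** * Averagedness of additive maps as a quadratic inequality *)

Section LinearAveraged.
Context {R : realType} {X : completeNormedModType R}.
Variable dot : {dot X for idfun}.
Hypothesis normE : forall x : X, `|x| ^+ 2 = dot x x.
Implicit Types (f : X -> X) (k : R).

(** After squaring, which [0 <= k] permits, the right side minus the left side is the same
    expression in both forms. *)
Lemma averaged_by_dotE f k : 0 <= k ->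
  (forall x, `|f x - (1 - k) *: x| <= k * `|x|) <->
  forall x, (1 - k) * dot (x - f x) (x - f x) <= k * (dot x x - dot (f x) (f x)).
Proof.
move=> k0.
have E x : (`|f x - (1 - k) *: x| <= k * `|x|) =
    ((1 - k) * dot (x - f x) (x - f x) <= k * (dot x x - dot (f x) (f x))).
  rewrite -ler_sqr ?nnegrE ?mulr_ge0// exprMn !normE !dotE [dot (f x) x]dotC.
  by rewrite -subr_ge0 -[RHS]subr_ge0; congr (0 <= _); ring.
by split=> H x; have := H x; rewrite E.
Qed.

(** An additive [f] fixes 0, so comparing [x] with 0 replaces comparing pairs of points. *)
Lemma averaged_by_dot f k x : {morph f : x y / x - y} -> averaged_by k f ->
  (1 - k) * dot (x - f x) (x - f x) <= k * (dot x x - dot (f x) (f x)).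
Proof.
move=> fB fk; have k0 : 0 <= k by case: fk => /andP[].
move: x; apply/(averaged_by_dotE f k0) => x.
have f0 : f 0 = 0 by rewrite -[X in f X](subrr 0) fB subrr.
by have := averaged_by_dist x 0 fk; rewrite f0 !subr0.
Qed.

Lemma averaged_by_of_dot f k : {morph f : x y / x - y} -> 0 < k <= 1 ->
  (forall x, (1 - k) * dot (x - f x) (x - f x)
             <= k * (dot x x - dot (f x) (f x))) ->
  averaged_by k f.
Proof.
move=> fB k01 H; apply: averaged_by_of_dist => // x y.
rewrite -fB; move: (x - y); apply/(averaged_by_dotE f _) => //.
by case/andP: k01 => /ltW.
Qed.

Lemma modulus_eq f k : averaged_by k f ->
  (forall k', averaged_by k' f -> k <= k') -> modulus f = k.
Proof.
move=> fk mk; apply: xget_unique => // k' [fk' mk'].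
by apply/eqP; rewrite eq_le mk// mk'.
Qed.

Lemma nonexpansive_averaged f k : averaged_by k f -> nonexpansive f.
Proof.
move=> [/andP[k0 k1] [N [Nne ->]]] x y; rewrite /relax.
rewrite opprD addrACA -!scalerBr; apply: le_trans (ler_normD _ _) _.
rewrite !normrZ (ger0_norm k0) ger0_norm ?subr_ge0//.
rewrite -lerBrDl -{1}[`|x - y|]mul1r -mulrBl subKr.
exact: ler_wpM2l.
Qed.

(** Additivity gives [f 0 = 0], under which [modulus_min] makes the modulus a genuine minimum and
    not the default of [xget]. *)
Lemma modulus_le f k : {morph f : x y / x - y} -> averaged_by k f ->
  averaged_by (modulus f) f /\ modulus f <= k.
Proof.
move=> fB fk; have f0 : f 0 = 0 by rewrite -[X in f X](subrr 0) fB subrr.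
by have [? H] := modulus_min (nonexpansive_averaged fk) f0; split=> //; exact: H.
Qed.

End LinearAveraged.

(** * The moduli of the two factors *)

Section ProjectionReflection.
Context {R : realType} {X : completeNormedModType R}.
Variable dot : {dot X for idfun}.
Hypothesis normE : forall x : X, `|x| ^+ 2 = dot x x.
Implicit Types (x y z u v w : X) (a b k e : R) (U V W : set X).
Local Notation P := (orth_proj dot).

(** Supplies the test vector for lower bounds on the moduli: [P V] vanishes at [w], and the
    quadratic inequality there becomes a bound on [k]. *)
Lemma orthc_nontrivial V : closed_subspace V -> V != setT ->
  exists2 w, orthc dot V w & 0 < dot w w.
Proof.
move=> cV /eqP VT; have [x nVx] : exists x, ~ V x.
  by apply/existsNP => VX; apply: VT; apply/seteqP; split.
exists (x - P V x); first by case: (orth_projP normE x cV).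
rewrite lt_neqAle dot_ge0// andbT eq_sym; apply/eqP => /(dot_eq0 normE)/eqP.
by rewrite subr_eq0 => /eqP xP; apply: nVx; rewrite xP; exact: orth_proj_in.
Qed.

(** At [k = 1 / 2] the quadratic inequality is Pythagoras; at [w] orthogonal to [U] it reads
    [1 - k <= k] up to the factor [dot w w]. *)
Lemma modulus_orth_proj U : closed_subspace U -> U != setT ->
  modulus (P U) = 1 / 2.
Proof.
move=> cU UT; have PB := fun x y => orth_projB normE x y cU.
apply: modulus_eq => [|k Pk].
  apply: (averaged_by_of_dot normE) => //; first lra.
  by move=> x; have := dot_projE normE x cU; lra.
have [w Uw w0] := orthc_nontrivial cU UT.
have := averaged_by_dot normE w PB Pk.
rewrite (orth_proj0 normE cU Uw) subr0 dot0l subr0 => H.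
by rewrite -(ler_pM2r w0); lra.
Qed.

Lemma relax_reflectorB V b : closed_subspace V ->
  {morph relax b (reflector dot V) : x y / x - y}.
Proof.
move=> cV x y; rewrite !(relax_reflectorE normE)// (orth_projB normE)//.
have E s t s' t' : s - t - (s' - t') = s - s' - (t - t') :> X.
  by rewrite !opprD !opprK addrACA.
by rewrite E scalerBr E.
Qed.

(** At [k = b] both sides equal 4 b^2 (1 - b) |x - P_V x|^2. At [w] orthogonal to [V] the map is
    multiplication by 1 - 2 b, and the inequality reduces to (1 - k) b <= k (1 - b). *)
Lemma modulus_relax_reflector V b : closed_subspace V -> V != setT ->
  0 < b < 1 -> modulus (relax b (reflector dot V)) = b.
Proof.
move=> cV VT b01; have TB := relax_reflectorB b cV.
apply: modulus_eq => [|k Tk].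
  apply: (averaged_by_of_dot normE) => //; first lra.
  move=> x; rewrite (relax_reflectorE normE)// subKr.
  have := dot_residual normE x cV; move: (x - P V x) => r xr.
  by rewrite !dotE (dotC dot r x) xr -subr_ge0 [leRHS](_ : _ = 0)//; ring.
have [w Vw w0] := orthc_nontrivial cV VT.
have := averaged_by_dot normE w TB Tk.
rewrite (relax_reflectorE normE)// (orth_proj0 normE cV Vw) !subr0 subKr.
rewrite !dotE => H; rewrite -subr_ge0 -(pmulr_rge0 _ w0).
rewrite -(pmulr_rge0 _ (_ : 0 < 4 * b)); first by nra.
by rewrite mulr_gt0//; case/andP: b01.
Qed.

End ProjectionReflection.

(** * Self-adjoint contractions in finite dimension *)

Section SelfAdjoint.
Context {R : realType} {X : completeNormedModType R}.
Variable dot : {dot X for idfun}.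
Hypothesis normE : forall x : X, `|x| ^+ 2 = dot x x.
Implicit Types (x y z u v w : X) (a b k e : R).
Variable A : X -> X.
Hypothesis A_lin : forall a x y, A (a *: x + y) = a *: A x + A y.
Hypothesis A_sym : forall x y, dot (A x) y = dot x (A y).
Hypothesis A_contr : forall x, `|A x| <= `|x|.

Let A0 : A 0 = 0.
Proof. by have := A_contr 0; rewrite normr0 normr_le0 => /eqP. Qed.

(** If A (A z) = 0 then |A z|^2 = <z, A (A z)> = 0, so the kernels of the positive powers of [A] all
    coincide. *)
Lemma self_adjoint_ker_iter (m : nat) x : iter m A x = 0 -> A x = 0.
Proof.
elim: m => [/= ->//|[//|m] IH /= AAz]; apply: IH => /=.
by apply: (dot_eq0 normE); rewrite A_sym AAz dot0r.
Qed.

(* Cayley-Hamilton gives A^m r(A) = 0 with r(0) != 0, hence A r(A) = 0 by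
   self_adjoint_ker_iter; dividing by r(0) expresses A as A s(A) A. *)
Lemma self_adjoint_finite_dimensional_bound : finite_dimensional X ->
  exists2 C, 0 < C & forall x, dot (A x) x <= C * dot (A x) (A x).
Proof.
(* The empty spanning family is treated apart, since [horner_mx] and Cayley-Hamilton are applied to
   matrices of size [n.+1]. *)
move=> [[|n] [g gX]].
  exists 1 => // x; have [c ->] := gX x.
  by rewrite big_ord0 A0 !dot0l mulr0.
pose phi (v : 'rV[R]_n.+1) := \sum_i v 0 i *: g i.
have phi_lin a (v w : 'rV_n.+1) : phi (a *: v + w) = a *: phi v + phi w.
  rewrite scaler_sumr -big_split; apply: eq_bigr => i _.
  by rewrite !mxE scalerDl scalerA.
have phi0 : phi 0 = 0 by apply: big1 => i _; rewrite mxE scale0r.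
have phi_onto x : exists v : 'rV_n.+1, x = phi v.
  have [c ->] := gX x; exists (\row_i c i).
  by apply: eq_bigr => i _; rewrite mxE.
have [c cP] := choice (fun i => gX (A (g i))).
(* The family [g] only spans, so [phi] need not be injective: [M] is one possible matrix of [A],
   acting on row vectors, and need not be symmetric. *)
pose M := \matrix_(i, j) c i j.
have Asum (I : finType) (F : I -> R) (h : I -> X) :
    A (\sum_i F i *: h i) = \sum_i F i *: A (h i).
  by apply: (big_rec2 (fun y x => A x = y)) => // i y x _ <-; rewrite A_lin.
have phiM (v : 'rV_n.+1) : A (phi v) = phi (v *m M).
  rewrite Asum; under eq_bigr do rewrite cP scaler_sumr.
  rewrite exchange_big; apply: eq_bigr => j _.
  rewrite mxE scaler_suml; apply: eq_bigr => i _.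
  by rewrite scalerA mxE.
have phi_iter (m : nat) (v : 'rV_n.+1) : iter m A (phi v) = phi (v *m M ^+ m).
  elim: m => [|m IH]; first by rewrite expr0 mulmx1.
  by rewrite iterS IH phiM exprSr -mulmxA.
(* Horner's rule and the contractivity of [A] bound s(A) by the sum of the absolute values of the
   coefficients of [s]. *)
have poly_bound (s : {poly R}) : exists2 C, 0 <= C &
    forall v : 'rV_n.+1, `|phi (v *m horner_mx M s)| <= C * `|phi v|.
  elim/poly_ind: s => [|s a [C C0 IH]].
    by exists 0 => // v; rewrite rmorph0 mulmx0 phi0 normr0 mul0r.
  exists (C + `|a|) => [|v]; first by rewrite addr_ge0.
  rewrite rmorphD rmorphM /= horner_mx_X horner_mx_C mulmxDr mul_mx_scalar.
  rewrite addrC phi_lin [leRHS]mulrDl [leRHS]addrC.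
  apply: le_trans (ler_normD _ _) _; rewrite normrZ lerD2l.
  by rewrite mulmxA -phiM; apply: le_trans (A_contr _) _.
have p0 : char_poly M != 0 by rewrite monic_neq0 ?char_poly_monic.
have [m [r + pE]] := multiplicity_XsubC (char_poly M) 0.
rewrite p0 /= => r0.
have [s rE] : exists s, r = s * 'X + r.[0]%:P.
  have : root (r - r.[0]%:P) 0 by rewrite /root !hornerE subrr.
  by move=> /factor_theorem[s]; rewrite subr0 => E; exists s; rewrite -E subrK.
have [C C0 Cs] := poly_bound s.
have rp : 0 < `|r.[0]| by rewrite normr_gt0.
exists ((C + 1) / `|r.[0]|); first by rewrite divr_gt0// ltr_wpDl.
move=> x; have [v vx] := phi_onto x.
have key : r.[0] *: A x = - phi (v *m M *m horner_mx M s *m M).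
  apply/eqP; rewrite -addr_eq0 vx phiM -phi_lin.
  have : A (phi (v *m horner_mx M r)) = 0.
    apply: (@self_adjoint_ker_iter m).
    have := Cayley_Hamilton M; rewrite pE rmorphM rmorphXn /=.
    rewrite subr0 horner_mx_X => E.
    by rewrite phi_iter -mulmxA mulmxE E mulmx0.
  rewrite phiM {1}rE rmorphD rmorphM /= horner_mx_X horner_mx_C => E.
  apply/eqP; rewrite -[RHS]E; congr phi.
  rewrite mulmxDr mul_mx_scalar mulmxDl -scalemxAl addrC; congr (_ + _).
  rewrite !mulmxA; congr (_ *m M); rewrite -!mulmxA; congr (_ *m _).
  exact: (comm_mx_horner _ _).
have -> : (C + 1) / `|r.[0]| * dot (A x) (A x) =
    `|r.[0]|^-1 * ((C + 1) * dot (A x) (A x)) by ring.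
rewrite ler_pdivlMl//; apply: le_trans (_ : `|dot (r.[0] *: A x) x| <= _).
  by rewrite dotZl normrM ler_wpM2l// ler_norm.
(* Symmetry moves the outer [A] onto [x], so s(A) A x is paired with A x; Cauchy-Schwarz and [Cs]
   then give C |A x|^2. *)
rewrite key dotNl normrN -phiM A_sym.
apply: le_trans (normr_dot_le normE _ _) _.
have := Cs (v *m M); rewrite -phiM -vx -normE expr2 mulrA => H.
rewrite ler_wpM2r//; apply: le_trans H _.
by rewrite ler_wpM2r// lerDl.
Qed.

End SelfAdjoint.

(** * The composition [T b], its modulus and the Friedrichs angle *)

Section Composition.
Context {R : realType} {X : completeNormedModType R}.
Variable dot : {dot X for idfun}.
Hypothesis normE : forall x : X, `|x| ^+ 2 = dot x x.
Implicit Types (x y z u v w : X) (a b k e : R).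
Local Notation P := (orth_proj dot).
Variables U V : set X.
Hypotheses (cU : closed_subspace U) (cV : closed_subspace V).

Local Notation T b := (relax b (reflector dot V) \o P U).
Local Notation Q u := (u - P V u).

Lemma comp_relax_reflectorB b : {morph T b : x y / x - y}.
Proof.
by move=> x y; rewrite /= (orth_projB normE)// (relax_reflectorB normE).
Qed.

(* With u = P_U x, w = x - u and q = u - P_V u, one has x - T x = w + 2 b q
   and |x|^2 - |T x|^2 = |w|^2 + 4 b (1 - b) |q|^2. *)
Lemma averaged_comp_dot b k x :
  ((1 - k) * dot (x - T b x) (x - T b x)
   <= k * (dot x x - dot (T b x) (T b x))) =
  ((1 - k) * (dot (x - P U x) (x - P U x)
              + 4 * b * dot (x - P U x) (Q (P U x))
              + 4 * b ^+ 2 * dot (Q (P U x)) (Q (P U x)))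
   <= k * (dot (x - P U x) (x - P U x)
           + 4 * b * (1 - b) * dot (Q (P U x)) (Q (P U x)))).
Proof.
rewrite /= (relax_reflectorE normE)//.
have Ux := orth_proj_in normE x cU.
have wu := orth_proj_residual normE x cU Ux.
have uq := dot_residual normE (P U x) cV.
move: (P U x) wu uq => u; move: (u - P V u) => q wu uq.
have xT : x - (u - (2 * b) *: q) = (x - u) + (2 * b) *: q.
  by rewrite opprB addrA addrAC.
have xx : dot x x = dot (x - u) (x - u) + dot u u.
  by move: wu; rewrite !dotE (dotC dot u x); lra.
rewrite xT xx; move: (x - u) => w.
by rewrite !dotE (dotC dot q w) (dotC dot q u) uq; congr (_ <= _); ring.
Qed.

Lemma comp_averaged b : 0 < b < 1 -> averaged_by (1 / (2 - b)) (T b).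
Proof.
move=> b01.
have b2 : 0 < 2 - b by lra.
apply: (averaged_by_of_dot normE).
- exact: comp_relax_reflectorB.
- by rewrite divr_gt0//= ler_pdivrMr// mul1r; lra.
move=> x; rewrite averaged_comp_dot// -subr_ge0.
move: (x - P U x) (P U x - _) => w q.
have := dot_ge0 normE (w - (2 * (1 - b)) *: q).
rewrite !dotE (dotC dot q w) => D0.
have k0 : 0 < b / (2 - b) by rewrite divr_gt0//; lra.
have := mulr_ge0 (ltW k0) D0; congr (0 <= _); field; lra.
Qed.

(** The test point is [x = u + w] with w = 2 (1 - b) P_(U^perp) q. It leaves only the [U]-component
    of w - 2 (1 - b) q, and so makes the slack at 1 / (2 - b) as small as [q] allows. *)
Lemma comp_averaged_lt b k :
  0 < b < 1 -> averaged_by k (T b) -> k < 1 / (2 - b) ->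
  exists2 e, 0 < e <= 1 & forall u, U u ->
    e * dot (Q u) (Q u) <= dot (P U (Q u)) (P U (Q u)).
Proof.
move=> b01; have b2 : 0 < 2 - b by lra.
move=> Tk; have [/andP[k0 k1] _] := Tk; rewrite ltr_pdivlMr// => kb.
exists (1 - k * (2 - b)).
  by have : 0 <= k * (2 - b) by [rewrite mulr_ge0// ltW]; lra.
move=> u Uu; pose q := Q u; pose r := q - P U q.
pose x := u + (2 * (1 - b)) *: r.
have Ur : orthc dot U r by case: (orth_projP normE q cU).
have Px : P U x = u.
  apply: orth_proj_unique => // v Uv; rewrite /x addrAC subrr add0r dotZl.
  by rewrite Ur// mulr0.
have := averaged_by_dot normE x (comp_relax_reflectorB b) Tk.
rewrite averaged_comp_dot// Px -/q.
have -> : x - u = (2 * (1 - b)) *: r by rewrite /x addrAC subrr add0r.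
have rq : dot r q = dot r r by rewrite dotC; exact: dot_residual.
have qq : dot q q = dot (P U q) (P U q) + dot r r by exact: dot_projE.
rewrite -/q; clear Px Ur x; clearbody r q; rewrite !dotE rq qq.
have := dot_ge0 normE r; have := dot_ge0 normE (P U q).
move: (dot r r) (dot (P U q) _) => A S S0 A0 H.
(* Here A = |P_(U^perp) q|^2 and S = |P_U q|^2. Divided by 4, [H] bounds 1 - k (2 - b) times [A] by
   a multiple of [S]; adding the same factor times [S] completes |q|^2 on the left. The resulting
   coefficient of [S] is at most 1. *)
have : (1 - k * (2 - b)) * (S + A) <=
       ((1 - k) * (1 - b ^+ 2) - k * (1 - b) ^+ 2) * S by nra.
move=> {}H; apply: le_trans H _; rewrite ler_piMl//.
have : 0 <= (1 - k) * b ^+ 2 by rewrite mulr_ge0 ?sqr_ge0// subr_ge0.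
have : 0 <= k * (1 - b) ^+ 2 by rewrite mulr_ge0 ?sqr_ge0//.
nra.
Qed.

(** The slack at [k0] is k0 b D with D = |w - 2 (1 - b) q|^2. The hypothesis makes [D] dominate
    |q|^2, hence also |w|^2, which leaves room to shrink [k0] by a factor 1 - s. *)
Lemma averaged_lt_comp b e : 0 < b < 1 -> 0 < e ->
  (forall u, U u -> e * dot (Q u) (Q u) <= dot (P U (Q u)) (P U (Q u))) ->
  exists2 k, k < 1 / (2 - b) & averaged_by k (T b).
Proof.
move=> b01 e0 H; have b2 : 0 < 2 - b by lra.
have [c cE] : exists c, c = 4 * (1 - b) ^+ 2 * e by eexists.
have c0 : 0 < c by rewrite cE mulr_gt0// mulr_gt0// exprn_gt0//; lra.
pose k0 := 1 / (2 - b).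
have k0p : 0 < k0 by rewrite divr_gt0.
have k01 : k0 <= 1 by rewrite ler_pdivrMr//; lra.
have d0 : 0 < 12 * (2 * c + 9) by lra.
(* Chosen to combine [NE], whose constant is 12, with [cAY], whose ratio is (2 c + 9) / c, into
   exactly [b * D]. *)
pose s := b * c / (12 * (2 * c + 9)).
have sE : s * (12 * (2 * c + 9)) = b * c by rewrite /s divfK// gt_eqF.
have s0 : 0 < s by rewrite divr_gt0// mulr_gt0//; lra.
have s1 : s < 1 by rewrite ltr_pdivrMr//; nra.
exists (k0 * (1 - s)); first by rewrite gtr_pMr//; lra.
apply: (averaged_by_of_dot normE).
- exact: comp_relax_reflectorB.
- by rewrite mulr_gt0 ?subr_gt0//=; nra.
move=> x; rewrite averaged_comp_dot//.
have [_ Uw] := orth_projP normE x cU.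
have := H _ (orth_proj_in normE x cU).
move: (x - P U x) Uw (Q (P U x)) => w Uw q qS.
(* As [w] is orthogonal to [U], the [U]-component of w - 2 (1 - b) q is -2 (1 - b) P_U q. *)
have Dq : 4 * (1 - b) ^+ 2 * dot (P U q) (P U q) <=
    dot (w - (2 * (1 - b)) *: q) (w - (2 * (1 - b)) *: q).
  rewrite [leRHS](dot_projE normE _ cU).
  rewrite (_ : P U (w - _) = - ((2 * (1 - b)) *: P U q)); last first.
    rewrite orth_projB// (orth_proj0 normE cU Uw) sub0r -[X in P U X]addr0.
    rewrite orth_proj_linear// [P U 0]orth_proj0 ?addr0//.
    by move=> v _; rewrite dot0l.
  rewrite -[leLHS]addr0; apply: lerD; last exact: dot_ge0.
  by rewrite !dotE le_eqVlt; apply/orP; left; apply/eqP; ring.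
have := dot_ge0 normE q; have := dot_ge0 normE w.
(* These two squares absorb the cross term [dot w q]: this one yields [cA], the next one [NE]. *)
have := dot_ge0 normE (w - (4 * (1 - b)) *: q).
have := dot_ge0 normE (w - (2 * b) *: q).
move: Dq; rewrite !dotE (dotC dot q w).
move: qS; move: (dot (P U q) _) (dot w w) (dot w q) (dot q q) => S A B Y.
move=> qS Dq N0 M0 A0 Y0.
set D := (X in _ <= X) in Dq.
have cY : c * Y <= D.
  apply: le_trans Dq; rewrite cE -mulrA ler_wpM2l// mulr_ge0// ?sqr_ge0//.
have cA : A <= 2 * D + 8 * (1 - b) ^+ 2 * Y by rewrite /D; nra.
have D0 : 0 <= D by apply: le_trans cY; rewrite mulr_ge0// ltW.
have cAY : c * (A + Y) <= (2 * c + 9) * D.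
  have : c * A <= c * (2 * D + 8 * Y).
    rewrite ler_pM2l//; apply: le_trans cA _; rewrite lerD2l.
    by rewrite ler_wpM2r//; nra.
  nra.
have NE : (A + 4 * b * B + 4 * b ^+ 2 * Y) + (A + 4 * b * (1 - b) * Y)
    <= 12 * (A + Y).
  have : b ^+ 2 * Y <= Y by rewrite ler_piMl//; nra.
  have : b * Y <= Y by rewrite ler_piMl//; lra.
  nra.
have sD : s * ((A + 4 * b * B + 4 * b ^+ 2 * Y) + (A + 4 * b * (1 - b) * Y))
    <= b * D.
  apply: le_trans (ler_wpM2l (ltW s0) NE) _.
  rewrite -(ler_pM2r d0).
  rewrite [leLHS]mulrAC sE [leLHS](_ : _ = 12 * b * (c * (A + Y))); last ring.
  rewrite [leRHS](_ : _ = 12 * b * ((2 * c + 9) * D)); last by ring.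
  by rewrite ler_wpM2l//; lra.
(* With [k0] cancelled, the goal (1 - b + s) N <= (1 - s) E rearranges to s (N + E) <= E - (1 - b) N
   = b D, which is [sD]. *)
have -> : 1 - k0 * (1 - s) = k0 * (1 - b + s).
  by rewrite /k0; field; lra.
rewrite -[leLHS]mulrA -[leRHS]mulrA ler_pM2l//.
move: sD; rewrite /D; clear; lra.
Qed.

(** The lower bound on u |-> Q u is immediate only on the range [W] of u |-> P_U (Q u); it passes to
    U [&] (U [&] V)^perp because [W] is dense there. *)
Lemma cos_friedrichs_lt1 e : 0 < e <= 1 ->
  (forall u, U u -> e * dot (Q u) (Q u) <= dot (P U (Q u)) (P U (Q u))) ->
  cos_friedrichs dot U V < 1.
Proof.
move=> /andP[e0 e1] H.
pose W := [set P U (Q u) | u in U].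
have QP2 a x y : Q (a *: x + y) = a *: Q x + Q y.
  by rewrite orth_proj_linear// opprD addrACA -scalerBr.
have QB x y : Q (x - y) = Q x - Q y.
  by rewrite orth_projB// !opprD !opprK addrACA.
have U0 : U 0 by case: cU.
have cW : closed_subspace (closure W).
  apply: closed_subspace_closure => [|a _ _ [u Uu <-] [v Uv <-]].
    have V0 : V 0 by case: cV.
    by exists 0 => //; rewrite (orth_proj_id normE cV V0) subr0 orth_proj_id.
  exists (a *: u + v); first by case: cU => _ + _; apply.
  by rewrite QP2 orth_proj_linear.
have closureS A : closed A -> W `<=` A -> closure W `<=` A.
  by move=> cA WA; rewrite (closure_id A).1//; exact: closure_subset.
have WU : closure W `<=` U.
  apply: closureS; first by case: cU.
  by move=> _ [u Uu <-]; exact: orth_proj_in.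
have dotPU u v := @dot_orth_proj_l _ _ dot normE U u v cU.
have WI : closure W `<=` orthc dot (U `&` V).
  apply: closureS; first by case: (closed_subspace_orthc normE (U `&` V)).
  move=> _ [u Uu <-] v [Uv Vv]; rewrite dotPU//.
  exact: orth_proj_residual.
(* The residual z - p from the closure of [W] lies in [U] and is orthogonal to P_U Q (z - p), so |Q
   (z - p)|^2 = 0 and z - p lies in U [&] V. Both [z] and [p] are orthogonal to that intersection,
   hence z = p. *)
have dense z : (U `&` orthc dot (U `&` V)) z -> closure W z.
  move=> [Uz Iz]; have [Wp zp] := orth_projP normE z cW.
  move: (P _ z) Wp zp => p Wp zp.
  have Us : U (z - p) by apply: subspaceB => //; exact: WU.
  have Vs : V (z - p).
    have : dot (z - p) (P U (Q (z - p))) = 0.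
      by apply: zp; apply: subset_closure; exists (z - p).
    rewrite dotC dotPU// dotC dot_residual// => /(dot_eq0 normE)/eqP.
    by rewrite subr_eq0 => /eqP ->; exact: orth_proj_in.
  suff /eqP : z - p = 0 by rewrite subr_eq0 => /eqP ->.
  apply: (dot_eq0 normE); rewrite dotDl dotNl Iz//.
  by rewrite (WI _ Wp)// subrr.
have QN x : `|Q x| <= `|x|.
  rewrite (norm_le_dot normE) [leRHS](dot_projE normE x cV) lerDr.
  exact: dot_ge0.
have s0 : 0 <= Num.sqrt e by exact: sqrtr_ge0.
(* For y = P_U (Q v), |y|^2 = <Q v, y> = <Q v, Q y> <= |Q v| |Q y|, while the hypothesis gives sqrt
   e |Q v| <= |y|. *)
have boundW y : W y -> Num.sqrt e * `|y| <= `|Q y|.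
  move=> [v Uv zE].
  have zz : dot y y <= `|Q v| * `|Q y|.
    have Uy : U y by rewrite -zE; exact: orth_proj_in.
    rewrite -{1}zE dotPU//; apply: le_trans (dot_le_norm normE _ _).
    rewrite [leRHS]dotDr dotNr (orth_proj_residual normE v cV (v := P V y)).
      by rewrite subr0.
    exact: orth_proj_in.
  have vz : Num.sqrt e * `|Q v| <= `|y|.
    rewrite -ler_sqr ?nnegrE ?mulr_ge0// exprMn sqr_sqrtr ?(ltW e0)//.
    by rewrite !normE -zE; exact: H.
  have [->|yn] := eqVneq y 0; first by rewrite normr0 mulr0.
  have y1 : 0 < `|y| by rewrite normr_gt0.
  rewrite -(ler_pM2r y1) -mulrA -expr2 normE.
  apply: le_trans (ler_wpM2l s0 zz) _.
  by rewrite mulrA [leRHS]mulrC ler_wpM2r.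
have bound z : (U `&` orthc dot (U `&` V)) z -> e * dot z z <= dot (Q z) (Q z).
  move=> /dense/closure_norm Wz.
  suff : Num.sqrt e * `|z| <= `|Q z|.
    rewrite -ler_sqr ?nnegrE ?mulr_ge0// exprMn sqr_sqrtr ?(ltW e0)//.
    by rewrite !normE.
  apply/ler_addgt0Pr => d d0.
  (* Replacing [z] by [y] costs sqrt e |z - y| on the left and, [Q] being 1-Lipschitz, |z - y| on
     the right. *)
  have s1 : 0 < 1 + Num.sqrt e by rewrite ltr_pwDl.
  have [y Wy zy] := Wz _ (divr_gt0 d0 s1).
  move: zy; rewrite ltr_pdivlMr// => zy.
  have h1 : `|z| <= `|y| + `|z - y|.
    by rewrite -{1}(subrK y z) addrC ler_normD.
  have h2 : `|Q y| <= `|Q z| + `|z - y|.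
    rewrite -[Q y](subKr (Q z)) -QB.
    by apply: le_trans (ler_normB _ _) _; rewrite lerD2l.
  have h3 := boundW _ Wy.
  have := ler_wpM2l s0 h1; nra.
(* In the unit balls, <u, v> = <P_V u, v> <= (|P_V u|^2 + |v|^2) / 2, and |P_V u|^2 = |u|^2 - |Q
   u|^2 <= 1 - e. *)
suff : cos_friedrichs dot U V <= 1 - e / 2 by lra.
apply: ge_sup.
  exists 0, 0, 0; split; rewrite ?normr0 ?dot0l//.
  - by split=> // v _; rewrite dot0l.
  - by split=> [|v _]; [case: cV|rewrite dot0l].
move=> _ [u [v [Uu [Vv _] u1 v1 ->]]].
have := bound _ Uu; have := dot_projE normE u cV.
have := orth_proj_residual normE u cV Vv.
have := dot_ge0 normE (P V u - v).
have : (1 - e) * dot u u <= 1 - e.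
  by rewrite ler_piMr ?subr_ge0// -normE expr_le1.
have : dot v v <= 1 by rewrite -normE expr_le1.
move: (dot (u - P V u) (u - P V u)) => D.
by rewrite !dotE (dotC dot v (P V u)); lra.
Qed.

(** The self-adjoint contraction A = P_U P_(V^perp) P_U satisfies <A u, u> = |Q u|^2 and A u = P_U
    (Q u) on [U]. Inverting [C + 1] in place of [C] ensures e <= 1. *)
Lemma finite_dimensional_residual_bound : finite_dimensional X ->
  exists2 e, 0 < e <= 1 & forall u, U u ->
    e * dot (Q u) (Q u) <= dot (P U (Q u)) (P U (Q u)).
Proof.
move=> Xfin; pose A x := P U (P U x - P V (P U x)).
have A_lin a x y : A (a *: x + y) = a *: A x + A y.
  by rewrite /A !orth_proj_linear// opprD addrACA -scalerBr orth_proj_linear.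
have A_sym x y : dot (A x) y = dot x (A y).
  rewrite /A (orth_proj_sym normE _ _ cU) -(orth_proj_sym normE x _ cU).
  by rewrite dotDl dotDr dotNl dotNr (orth_proj_sym normE _ _ cV).
have A_contr x : `|A x| <= `|x|.
  apply: le_trans (norm_orth_proj_le normE _ cU) _.
  apply: le_trans (norm_orth_proj_le normE x cU).
  rewrite -orth_proj_orthc//; apply: (norm_orth_proj_le normE).
  exact: closed_subspace_orthc.
have [C C0 HC] :=
  self_adjoint_finite_dimensional_bound normE A_lin A_sym A_contr Xfin.
have C1 : 0 < C + 1 by lra.
exists (C + 1)^-1; first by rewrite invr_gt0 C1 invf_le1// lerDr ltW.
move=> u Uu; rewrite ler_pdivrMl//.
have AE : A u = P U (u - P V u) by rewrite /A (orth_proj_id normE cU Uu).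
have := HC u; rewrite AE dot_orth_proj_l// dotC dot_residual// => /le_trans.
by apply; rewrite ler_wpM2r ?lerDl// dot_ge0.
Qed.

Lemma modulus_comp_le b : 0 < b < 1 ->
  averaged_by (modulus (T b)) (T b) /\ modulus (T b) <= 1 / (2 - b).
Proof.
move=> b01; apply: modulus_le (comp_averaged b01); exact: comp_relax_reflectorB.
Qed.

Lemma modulus_comp_eq b : 0 < b < 1 -> cos_friedrichs dot U V = 1 ->
  modulus (T b) = 1 / (2 - b).
Proof.
move=> b01 c1; have [Tm mle] := modulus_comp_le b01.
apply/eqP; rewrite eq_le mle leNgt; apply/negP => mlt.
have [e e01 He] := comp_averaged_lt b01 Tm mlt.
by have := cos_friedrichs_lt1 e01 He; rewrite c1 ltxx.
Qed.

Lemma modulus_comp_lt b : 0 < b < 1 -> finite_dimensional X ->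
  cos_friedrichs dot U V < 1 /\ modulus (T b) < 1 / (2 - b).
Proof.
move=> b01 /finite_dimensional_residual_bound[e e01 He].
split; first exact: (cos_friedrichs_lt1 e01 He).
have e0 : 0 < e by case/andP: e01.
have [k klt Tk] := averaged_lt_comp b01 e0 He.
have [_ mk] := modulus_le (comp_relax_reflectorB b) Tk.
exact: le_lt_trans klt.
Qed.

End Composition.

(** * Subspaces at zero angle in infinite dimension *)

Section ZeroAngle.
Context {R : realType} {X : completeNormedModType R}.
Variable dot : {dot X for idfun}.
Hypothesis normE : forall x : X, `|x| ^+ 2 = dot x x.
Implicit Types (x y v : X) (U V : set X).

(** Gram-Schmidt: finitely many vectors never span [X], so the next vector is a normalized nonzero
    residual. *)
Lemma exists_orthonormal_sequence : ~ finite_dimensional X ->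
  exists e : nat -> X, forall i j, dot (e i) (e j) = (i == j)%:R.
Proof.
move=> Xinf.
(* Orthonormality of the given family is assumed under the existential, so that [choice] applies to
   every pair. *)
have step (nf : nat * (nat -> X)) : exists y,
    (forall i j, (i < nf.1)%N -> (j < nf.1)%N ->
      dot (nf.2 i) (nf.2 j) = (i == j)%:R) ->
    dot y y = 1 /\ forall i, (i < nf.1)%N -> dot y (nf.2 i) = 0.
  case: nf => n f /=; have [x xP] : exists x, forall c : 'I_n -> R,
      x <> \sum_(i < n) c i *: f i.
    apply: contrapT => /forallNP H; apply: Xinf; exists n, (fun i => f i) => x.
    by have /existsNP[c /contrapT cP] := H x; exists c.
  pose y := x - \sum_(i < n) dot x (f i) *: f i.
  have y0 : y != 0 by apply/eqP => /subr0_eq; exact: xP.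
  have yn : 0 < `|y| by rewrite normr_gt0.
  exists (`|y|^-1 *: y) => orth; split.
    by rewrite dotZl dotZr -normE expr2 mulKf ?gt_eqF// mulVf ?gt_eqF.
  move=> j jn; rewrite dotZl; apply/eqP; rewrite mulf_eq0; apply/orP; right.
  rewrite /y dotDl dotNl dot_suml (bigD1 (Ordinal jn))//= dotZl orth// eqxx.
  rewrite mulr1 big1 ?addr0 ?subrr// => i ij.
  rewrite dotZl orth// (_ : (i == j :> nat) = false) ?mulr0//.
  by apply/negbTE; apply: contra ij => /eqP ij; apply/eqP/val_inj.
have [f fP] := choice step.
(* [F n] carries the first [n] vectors; its values at indices [n] and beyond are irrelevant. *)
pose F := fix F n : nat -> X :=
  if n is m.+1 then fun i => if (i < m)%N then F m i else f (m, F m)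
  else fun=> 0.
pose e n := f (n, F n).
have FE n i : (i < n)%N -> F n i = e i.
  elim: n => // n IH; rewrite ltnS leq_eqVlt /= => /orP[/eqP ->|].
    by rewrite ltnn.
  by move=> lin; rewrite lin IH.
have orth n i j : (i < n)%N -> (j < n)%N -> dot (e i) (e j) = (i == j)%:R.
  elim: n i j => // n IH i j.
  have [|e1 en] := fP (n, F n).
    by move=> i' j' /= lti ltj; rewrite !FE// IH.
  have {}en i' : (i' < n)%N -> dot (e n) (e i') = 0.
    by move=> lti; have := en _ lti; rewrite /= FE.
  rewrite !ltnS (leq_eqVlt i) (leq_eqVlt j).
  move=> /orP[/eqP->|lti] /orP[/eqP->|ltj].
  - by rewrite eqxx.
  - by rewrite en// gtn_eqF.
  - by rewrite dotC en// ltn_eqF.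
  - exact: IH.
exists e => i j; apply: (orth (maxn i j).+1); rewrite ltnS.
  exact: leq_maxl.
exact: leq_maxr.
Qed.

(* The vectors e_(2n) of U and (1 - s_n) e_(2n) + s_n e_(2n+1) of V make an
   angle tending to 0, and V is the closed span of the latter, written as an
   orthogonal complement. *)
Lemma exists_zero_angle_subspaces : ~ finite_dimensional X ->
  exists U V : set X,
    [/\ closed_subspace U /\ closed_subspace V, U `<` setT /\ ~ U `<=` V,
        U `&` V = [set 0] & cos_friedrichs dot U V = 1].
Proof.
move=> /exists_orthonormal_sequence[e eP].
pose s n : R := n.+2%:R^-1.
have s0 n : 0 < s n by rewrite invr_gt0.
have s1 n : s n < 1 by rewrite invf_lt1// ltr1n.
pose g n := (1 - s n) *: e n.*2.+1 - s n *: e n.*2.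
pose U := orthc dot [set e n.*2.+1 | n in setT].
(* [g n] is normal to [f n] in the plane of the n-th pair. Adding [orthc dot (range e)] confines [V]
   to the closed span of the sequence; [U] may contain vectors orthogonal to all of it, and these
   must not survive in U [&] V. *)
pose V := orthc dot ([set g n | n in setT] `|` orthc dot (range e)).
have oe m n : (m.*2.+1 == n.*2) = false.
  by apply/negP => /eqP/(congr1 odd); rewrite /= !odd_double.
have eo m n : (n.*2 == m.*2.+1) = false by rewrite eq_sym oe.
have dbl m n : (m.*2 == n.*2) = (m == n) by rewrite -!muln2 eqn_pmul2r.
have Ue n : U (e n.*2).
  by move=> _ [m _ <-]; rewrite eP eo.
pose f n := (1 - s n) *: e n.*2 + s n *: e n.*2.+1.
have Vf n : V (f n).
  move=> v [[m _ <-]|Ev].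
    rewrite /f /g !dotE !eP oe eo eqSS !dbl.
    by have [->|_] := eqVneq n m; rewrite /=; ring.
  have {}Ev m : dot v (e m) = 0 by apply: Ev; exists m.
  by rewrite dotC /f !dotE !Ev !mulr0 addr0.
have UV0 : U `&` V = [set 0].
  apply/seteqP; split=> [x [Ux Vx]|_ ->]; last first.
    by split=> v _; rewrite dot0l.
  have odd0 n : dot x (e n.*2.+1) = 0 by apply: Ux; exists n.
  have even0 n : dot x (e n.*2) = 0.
    have : dot x (g n) = 0 by apply: Vx; left; exists n.
    rewrite /g !dotE odd0 mulr0 add0r => /eqP; rewrite oppr_eq0 mulf_eq0.
    by rewrite gt_eqF//= => /eqP.
  apply: (dot_eq0 normE); apply: Vx; right => _ [n _ <-].
  by rewrite -(odd_double_half n); case: (odd n); rewrite ?add1n ?add0n.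
exists U, V; split=> //.
- by split; exact: closed_subspace_orthc.
- split.
    split=> // /(_ (e 1%N) I)/(_ (e 1%N)); rewrite eP eqxx.
    by move=> /(_ (ex_intro2 _ _ 0%N I erefl))/eqP; rewrite oner_eq0.
  move=> /(_ _ (Ue 0%N))/(_ (g 0%N)); rewrite /g !dotE !eP /= => H.
  have : (s 0%N) = 0.
    have := H (or_introl (ex_intro2 _ _ 0%N I erefl)); lra.
  by move/eqP; rewrite gt_eqF.
rewrite /cos_friedrichs UV0.
set S := [set r | _].
have orth0 x : orthc dot [set 0] x by move=> _ ->; rewrite dot0r.
have Sle : ubound S 1.
  move=> _ [u [v [_ _ u1 v1 ->]]]; apply: le_trans (dot_le_norm normE _ _) _.
  by rewrite mulr_ile1.
(* [f n] lies in the unit ball because (1 - s)^2 + s^2 <= 1 for [s] in [0, 1]. *)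
have Sn n : S (1 - s n).
  exists (e n.*2), (f n); split; [by split|by split| | |].
  - by rewrite -(expr_le1 (n := 2))// normE eP eqxx.
  - rewrite -(expr_le1 (n := 2))// normE /f !dotE !eP oe eo !eqxx /=.
    have := s0 n; have := s1 n; nra.
  - by rewrite /f !dotE !eP eo eqxx /=; ring.
have hS : has_sup S by split; [exists (1 - s 0%N)|exists 1].
apply/eqP; rewrite eq_le ge_sup//=; last by case: hS.
(* If the supremum were below 1, some [n] would give sup S + 1 / (n + 1) < 1, against 1 - 1 / (n +
   2) <= sup S. *)
rewrite leNgt; apply/negP => /ltr_add_invr[n].
apply/negP; rewrite -leNgt -lerBlDr.
apply: le_trans (_ : 1 - s n <= _); last exact: sup_upper_bound.
by rewrite lerD2l lerN2 lef_pV2 ?posrE// ler_nat.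
Qed.

End ZeroAngle.

(** * Value of the Ogura-Yamada bound and assembly of the claims *)

Lemma OY_bound_half {R : realType} (b : R) : 0 < b < 1 ->
  OY_bound (1 / 2) b = 1 / (2 - b).
Proof. by move=> b01; rewrite /OY_bound; field; lra. Qed.

Theorem mainTheorem3 (R : realType) (X : completeNormedModType R)
    (dot : {dot X for idfun}) (normE : forall x : X, `|x| ^+ 2 = dot x x)
    (beta : R) (beta01 : 0 < beta < 1) :
  let T1 (U : set X) := orth_proj dot U in
  let T2 (V : set X) := relax beta (reflector dot V) in
  let T (U V : set X) := T2 V \o T1 U in
  (forall U V : set X, closed_subspace U -> closed_subspace V ->
    U `<` setT -> ~ U `<=` V ->
    [/\ modulus (T1 U) = 1 / 2,
        modulus (T2 V) = beta,
        OY_bound (modulus (T1 U)) (modulus (T2 V)) = 1 / (2 - beta),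
        cos_friedrichs dot U V = 1 ->
          modulus (T U V) = 1 / (2 - beta) /\
          modulus (T U V) = OY_bound (modulus (T1 U)) (modulus (T2 V))
      & finite_dimensional X ->
          cos_friedrichs dot U V < 1 /\ modulus (T U V) < 1 / (2 - beta)]) /\
  (~ finite_dimensional X ->
    exists U V : set X,
      [/\ closed_subspace U /\ closed_subspace V,
          U `<` setT /\ ~ U `<=` V,
          U `&` V = [set 0],
          cos_friedrichs dot U V = 1
        & modulus (T U V) = OY_bound (modulus (T1 U)) (modulus (T2 V))]).
Proof.
move=> T1 T2 T; split=> [U V cU cV [_ nUT] nUV|].
  have UT : U != setT by apply/eqP => UT; apply: nUT; rewrite UT.
  have VT : V != setT by apply/eqP => VT; apply: nUV; rewrite VT.
  rewrite modulus_orth_proj// modulus_relax_reflector// OY_bound_half//.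
  split=> // [c1|Xfin]; last exact: modulus_comp_lt.
  by rewrite modulus_comp_eq.
move=> /(exists_zero_angle_subspaces normE)[U [V [[cU cV] [UT nUV] UV0 c1]]].
have neT W W' : ~ W `<=` W' -> W' != setT :> set X.
  by move=> nWW'; apply/eqP => WT; apply: nWW'; rewrite WT.
exists U, V; split=> //.
rewrite modulus_comp_eq// modulus_orth_proj ?modulus_relax_reflector//.
- by rewrite OY_bound_half.
- exact: neT nUV.
- by case: UT => _ /neT.
Qed.
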